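(* Let $\mathcal{X}$ be a finite set with $|\mathcal{X}|=r\ge 2$, let $\mathcal{Z}=\{0,1,\ldots,k-1\}$ with $2\le k\le r$, and let $f:\mathcal{X}\to\mathcal{Z}$ be a given mapping. For each $n\ge 1$, the distribution $\rho$-privacy $\pi_n(\rho)$ is nonincreasing in $0\le\rho\le 1$, and $$\pi_n(\rho)\ \ge\ \omega(\rho),\qquad 0\le\rho\le 1,$$ and $$\pi_n(\rho)=\omega(\rho)=\log r,\qquad 0\le\rho\le \frac1k .$$
   Context: All logarithms are to base 2. $D(\cdot\|\cdot)$ is Kullback–Leibler divergence (possibly $+\infty$). $\Delta_r$ denotes the simplex of all probability mass functions (pmfs) on $\mathcal{X}$. For $z\in\mathcal{Z}$, $f^{-1}(z)=\{x\in\mathcal{X}: f(x)=z\}$. For $0\le\rho\le1$, a $\rho$-QR is a stochastic matrix $W:\mathcal{X}\to\mathcal{Z}$ (entries $W(z|x)\ge 0$, $\sum_{z}W(z|x)=1$ for every $x$) with $W(f(x)|x)\ge\rho$ for all $x\in\mathcal{X}$. For a pmf $P_X\in\Delta_r$, $P_XW$ is the pmf on $\mathcal{Z}$ given by $(P_XW)(z)=\sum_{x}P_X(x)W(z|x)$. For an estimator $\widehat P_n:\mathcal{Z}^n\to\Delta_r$ define $$\pi_n(\rho,W,P_X,\widehat P_n)=\mathbb{E}\big[D\big(P_X\,\|\,\widehat P_n(Z^n)\big)\big],$$ where $Z^n=(Z_1,\ldots,Z_n)$ are i.i.d. with pmf $P_XW$. Distribution $\rho$-privacy is $$\pi_n(\rho)=\sup_{W}\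 \inf_{\widehat P_n:\mathcal{Z}^n\to\Delta_r}\ \sup_{P_X\in\Delta_r}\ \pi_n(\rho,W,P_X,\widehat P_n),$$ the outer supremum being over all $\rho$-QRs $W$. The function $\omega$ is defined on $[0,1]$ by $$\omega(\rho)=\begin{cases}\log r, & 0\le\rho\le \frac1k,\\[2pt] \displaystyle\max_{\mathcal{Z}_l\subset\mathcal{Z},\ |\mathcal{Z}_l|=l}\ \log\sum_{j\in\mathcal{Z}_l}|f^{-1}(j)|, & \frac{1}{l+1}<\rho\le\frac1l,\ \ 1\le l\le k-1.\end{cases}$$ *)

(* Defs.v *)
From mathcomp Require Import all_boot all_order all_algebra.
From mathcomp Require Import boolp classical_sets reals ereal exp.

Set Implicit Arguments.
Unset Strict Implicit.
Unset Printing Implicit Defensive.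

Import Order.TTheory GRing.Theory Num.Theory.
Local Open Scope classical_set_scope.
Local Open Scope ring_scope.

Definition log2 (R : realType) (x : R) : R := ln x / ln 2.

Record fpmf (R : realType) (T : finType) := Fpmf {
  fpmf_fun :> T -> R;
  fpmf_ge0 : forall t, 0 <= fpmf_fun t;
  fpmf_sum1 : \sum_t fpmf_fun t = 1 }.

(* [W x z] is the entry W(z|x). *)
Definition stochastic (R : realType) (X Z : finType) := X -> fpmf R Z.

Section OutputPmf.
Variables (R : realType) (X Z : finType) (P : fpmf R X) (W : stochastic R X Z).

Let out z : R := \sum_x P x * W x z.

Let out_ge0 z : 0 <= out z.
Proof. by apply: sumr_ge0 => x _; rewrite mulr_ge0 ?fpmf_ge0. Qed.

Let out_sum1 : \sum_z out z = 1.
Proof.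
rewrite exchange_big -[RHS](fpmf_sum1 P); apply: eq_bigr => x _.
by rewrite -mulr_sumr fpmf_sum1 mulr1.
Qed.

Definition output_pmf : fpmf R Z := Fpmf out_ge0 out_sum1.

End OutputPmf.

(* Conventions: 0 log (0 / q) = 0 for every q, and p log (p / 0) = +oo for
   p > 0. *)
Definition KL (R : realType) (T : finType) (P Q : fpmf R T) : \bar R :=
  (\sum_t (if P t == 0%R then 0
           else if Q t == 0%R then +oo
           else (P t * log2 (P t / Q t))%R%:E))%E.

(* E[g(Z_1, ..., Z_n)] for Z_1, ..., Z_n i.i.d. with pmf Q; as 0 * +oo = 0 in
   \bar R, outcomes of probability 0 do not contribute. *)
Definition iid_expectation (R : realType) (Z : finType) (n : nat)
    (Q : fpmf R Z) (g : n.-tuple Z -> \bar R) : \bar R :=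
  (\sum_(z : n.-tuple Z) (\prod_(i < n) Q (tnth z i))%R%:E * g z)%E.

Section DistributionPrivacy.
Variables (R : realType) (X : finType) (k : nat) (f : X -> 'I_k).

Definition is_QR (rho : R) (W : stochastic R X 'I_k) : Prop :=
  forall x, rho <= W x (f x).

Definition estimator (n : nat) := n.-tuple 'I_k -> fpmf R X.

Definition privacy_risk (n : nat) (W : stochastic R X 'I_k) (P : fpmf R X)
    (Phat : estimator n) : \bar R :=
  iid_expectation (output_pmf P W) (fun z => KL P (Phat z)).

Definition privacy (n : nat) (rho : R) : \bar R :=
  ereal_sup [set ereal_inf [set ereal_sup [set privacy_risk W P Phat
                                          | P in [set: fpmf R X]]
                           | Phat in [set: estimator n]]
            | W in [set W | is_QR rho W]].

(* For 1/k < rho <= 1 exactly one l : 'I_k satisfies the condition under pick;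
   the last branch is never reached for 0 <= rho <= 1.  The default 0 of the
   maximum and the convention ln 0 = 0 are harmless: when X is nonempty and
   1 <= l <= k, some Zl contains the label of an element of X, so that the true
   maximum is the logarithm of an integer >= 1. *)
Definition omega (rho : R) : R :=
  if rho <= k%:R^-1 then log2 #|X|%:R
  else if [pick l : 'I_k | (0 < l)%N && (l.+1%:R^-1 < rho <= l%:R^-1)] is Some l
  then \big[Num.max/0]_(Zl : {set 'I_k} | #|Zl| == l)
         log2 (\sum_(j in Zl) #|[pred x | f x == j]|)%:R
  else 0.

End DistributionPrivacy.

(* Main.v *)
Require Import Defs.
From mathcomp Require Import all_boot all_order all_algebra.
From mathcomp Require Import boolp classical_sets reals ereal exp.
From mathcomp Require Import lra.

Set Implicit Arguments.
Unset Strict Implicit.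
Unset Printing Implicit Defensive.

Import Order.TTheory GRing.Theory Num.Theory.
Local Open Scope ring_scope.

(** A constant uniform guess of the pmf has risk at most log r, whatever W is.
    For the lower bound, take l labels Zl and let W output a uniform element of
    Zl when f x is in Zl.  The point masses at the points of A = f^-1(Zl) then
    all produce the same output distribution, so the estimate has the same
    law under each of them; its expectation, a pmf, gives some x in A mass at
    most 1 / #|A|, and the tangent bound -ln q >= ln #|A| + 1 - #|A| q turns
    this into risk at least log #|A| at the point mass at x. *)

(** * Uniform pmfs: guesses, channel rows and point masses *)

Section UniformPmf.
Variables (R : realType) (T : finType) (A : {set T}) (t0 : T).
Hypothesis At0 : t0 \in A.

Let unif t : R := (t \in A)%:R / #|A|%:R.

Let unif_ge0 t : 0 <= unif t.
Proof. by rewrite divr_ge0. Qed.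

Let unif_sum1 : \sum_t unif t = 1.
Proof.
rewrite -mulr_suml -natr_sum -big_mkcond /= sum1_card divff //.
by rewrite pnatr_eq0 -lt0n; apply/card_gt0P; exists t0.
Qed.

Definition uniform_pmf : fpmf R T := Fpmf unif_ge0 unif_sum1.

End UniformPmf.

Definition dirac_pmf (R : realType) (T : finType) (t : T) : fpmf R T :=
  uniform_pmf R (set11 t).

(** * The law of n i.i.d. outputs *)

Section IidPmf.
Variables (R : realType) (Z : finType) (n : nat) (Q : fpmf R Z).

Let iid (z : n.-tuple Z) : R := \prod_(i < n) Q (tnth z i).

Let iid_ge0 z : 0 <= iid z.
Proof. by apply: prodr_ge0 => i _; apply: fpmf_ge0. Qed.

Let iid_sum1 : \sum_z iid z = 1.
Proof.
(* Tuples are traded for finite functions, so that the sum of products factors into a product of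
   sums, each equal to 1. *)
rewrite /iid (reindex (fun g : {ffun 'I_n -> Z} => [tuple g i | i < n])) /=;
  last first.
  exists (fun z : n.-tuple Z => [ffun i => tnth z i]) => [g|z] _.
    by apply/ffunP => i; rewrite ffunE tnth_mktuple.
  by apply: eq_from_tnth => i; rewrite tnth_mktuple ffunE.
under eq_bigr do under eq_bigr do rewrite tnth_mktuple.
rewrite -(bigA_distr_bigA (fun _ => Q)) big1 // => i _.
exact: fpmf_sum1.
Qed.

(** Packed as a pmf, the law of the outputs can be fed to [output_pmf], with an estimator seen as a
    channel from tuples to pmfs. *)
Definition iid_pmf : fpmf R (n.-tuple Z) := Fpmf iid_ge0 iid_sum1.

Lemma iid_expectation_ge (g : n.-tuple Z -> R) (h : n.-tuple Z -> \bar R) :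
  (forall z, ((g z)%:E <= h z)%E) ->
  ((\sum_z iid_pmf z * g z)%:E <= iid_expectation Q h)%E.
Proof.
move=> gh; rewrite -sumEFin; apply: lee_sum => z _.
by rewrite EFinM lee_wpmul2l // lee_fin iid_ge0.
Qed.

Lemma iid_expectation_le (c : R) (h : n.-tuple Z -> \bar R) :
  (forall z, (h z <= c%:E)%E) -> (iid_expectation Q h <= c%:E)%E.
Proof.
move=> hc; rewrite -[c]mul1r -iid_sum1 mulr_suml -sumEFin.
by apply: lee_sum => z _; rewrite EFinM lee_wpmul2l // lee_fin iid_ge0.
Qed.

End IidPmf.

(** * Divergence to a uniform guess and from a point mass *)

Section Divergence.
Variables (R : realType) (T : finType).
Implicit Types (P Q : fpmf R T) (A : {set T}).

Lemma fpmf_le1 P t : P t <= 1.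
Proof.
rewrite -(fpmf_sum1 P) (bigD1 t) //= lerDl sumr_ge0 // => u _.
exact: fpmf_ge0.
Qed.

Lemma ln2_gt0 : 0 < ln (2 : R).
Proof. by rewrite ln_gt0 // ltr1n. Qed.

Lemma log2_nat_ge0 m : 0 <= log2 (m%:R : R).
Proof.
rewrite /log2 divr_ge0 ?(ltW ln2_gt0) //.
by case: m => [|m]; [rewrite ln0 | rewrite ln_ge0 // ler1n].
Qed.

(** Each logarithm is that of [P t * #|T|], which is at most [#|T|] since [P t <= 1]. *)
Lemma KL_uniform_le P (t0 : T) :
  (KL P (uniform_pmf R (finset.in_setT t0)) <= (log2 #|T|%:R)%:E)%E.
Proof.
have T_gt0 : 0 < (#|T|%:R : R) by rewrite ltr0n; apply/card_gt0P; exists t0.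
rewrite -[log2 _]mul1r -[X in X * log2 _](fpmf_sum1 P) mulr_suml -sumEFin.
apply: lee_sum => t _; rewrite /= finset.in_setT cardsT mul1r.
have [->|Pt_neq0] := eqVneq; first by rewrite mul0r.
rewrite invr_eq0 (gt_eqF T_gt0) invrK lee_fin.
have Pt_gt0 : 0 < P t by rewrite lt_neqAle eq_sym Pt_neq0 fpmf_ge0.
rewrite ler_pM2l // /log2 ler_pM2r ?invr_gt0 ?ln2_gt0 //.
by rewrite ler_ln ?posrE ?mulr_gt0 // ger_pMl // fpmf_le1.
Qed.

(** The divergence is [- log2 (Q x)], bounded by the tangent at [Q x = 1 / a]. The bound is affine
    in [Q x], so its average over random estimates depends only on the mean of [Q x]. *)
Lemma KL_dirac_ge Q (x : T) (a : R) : 0 < a ->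
  ((log2 a + (1 - a * Q x) / ln 2)%:E <= KL (dirac_pmf R x) Q)%E.
Proof.
move=> a_gt0; rewrite /KL (bigD1 x) //= big1 ?adde0; last first.
  by move=> t /negPf tx; rewrite inE tx mul0r eqxx.
rewrite inE eqxx cards1 divr1 oner_eq0.
have [_|Qx_neq0] := eqVneq (Q x) 0; first exact: leey.
have Qx_gt0 : 0 < Q x by rewrite lt_neqAle eq_sym Qx_neq0 fpmf_ge0.
rewrite lee_fin mul1r -mulrDl /log2 ler_pM2r ?invr_gt0 ?ln2_gt0 //.
rewrite mul1r lnV ?posrE //.
have : ln (1 + (a * Q x - 1)) <= a * Q x - 1.
  by rewrite le_ln1Dx // ltrBrDr addNr mulr_gt0.
rewrite subrKC lnM ?posrE //; lra.
Qed.

(** Otherwise the masses on [A] would add up to more than 1. *)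
Lemma exists_small_mass Q A (t0 : T) : t0 \in A ->
  exists2 t, t \in A & #|A|%:R * Q t <= 1.
Proof.
move=> At0; have A_gt0 : 0 < (#|A|%:R : R).
  by rewrite ltr0n; apply/card_gt0P; exists t0.
apply: contrapT => no_t; suff : (1 : R) < 1 by rewrite ltxx.
have Q_gt t : t \in A -> #|A|%:R^-1 < Q t.
  move=> At; rewrite ltNge; apply/negP => le_Q; apply: no_t; exists t => //.
  by rewrite -ler_pdivlMl // mulr1.
have sumA : \sum_(t in A) #|A|%:R^-1 = 1 :> R.
  by rewrite sumr_const -[LHS]mulr_natr mulVf ?lt0r_neq0.
rewrite -[ltLHS]sumA -[ltRHS](fpmf_sum1 Q).
apply: (@lt_le_trans _ _ (\sum_(t in A) Q t)).
  by apply: ltr_sum => //; apply/hasP; exists t0; rewrite ?mem_index_enum.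
rewrite [leRHS](bigID (mem A)) /= lerDl sumr_ge0 // => t _.
exact: fpmf_ge0.
Qed.

End Divergence.

(** * Bounds on the distribution privacy *)

Section Privacy.
Variables (R : realType) (X : finType) (k : nat) (f : X -> 'I_k) (n : nat).
Implicit Types (Zl : {set 'I_k}) (rho : R).

Lemma privacy_nonincreasing rho rho' :
  rho <= rho' -> (privacy f n rho' <= privacy f n rho)%E.
Proof.
move=> le_rho; apply: ereal_sup_le => _ [W W_QR <-]; exists W => // x.
exact: le_trans le_rho (W_QR x).
Qed.

Lemma privacy_le (x0 : X) rho : (privacy f n rho <= (log2 #|X|%:R)%:E)%E.
Proof.
apply: ge_ereal_sup => _ [W _ <-]; apply: ge_ereal_inf.
pose U : estimator R X k n := fun=> uniform_pmf R (finset.in_setT x0).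
eexists; first by exists U.
apply: ge_ereal_sup => _ [P _ <-]; apply: iid_expectation_le => z.
exact: KL_uniform_le.
Qed.

Section Confusion.
Variable Zl : {set 'I_k}.

(** Labels outside [Zl] get a singleton block: they are output without noise. *)
Let block x : {set 'I_k} := if f x \in Zl then Zl else [set f x].

Let mem_block x : f x \in block x.
Proof. by rewrite /block; case: ifP => // _; apply: set11. Qed.

Definition confusing_QR : stochastic R X 'I_k :=
  fun x => uniform_pmf R (mem_block x).

Lemma confusing_QR_is_QR rho :
  (0 < #|Zl|)%N -> rho <= #|Zl|%:R^-1 -> is_QR f rho confusing_QR.
Proof.
move=> Zl_gt0 le_rho x; rewrite /= mem_block mul1r /block; case: ifP => // _.
by rewrite cards1 (le_trans le_rho) // invr1 invf_le1 ?ltr0n // ler1n.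
Qed.

(** The right side does not depend on [x], so the outputs cannot tell apart points with labels in
    [Zl]. The point [x0] witnesses that [Zl] is nonempty. *)
Lemma output_confusing_QR (x x0 : X) : f x \in Zl -> forall f_x0 : f x0 \in Zl,
  output_pmf (dirac_pmf R x) confusing_QR =1 uniform_pmf R f_x0.
Proof.
move=> fx f_x0 z; rewrite /output_pmf /= (bigD1 x) //= big1 ?addr0.
  by rewrite inE eqxx cards1 divr1 mul1r /block fx.
by move=> t /negPf tx; rewrite inE tx !mul0r.
Qed.

Lemma log2_card_le_privacy (x0 : X) rho : f x0 \in Zl -> rho <= #|Zl|%:R^-1 ->
  ((log2 #|[set x | f x \in Zl]|%:R)%:E <= privacy f n rho)%E.
Proof.
move=> f_x0 le_rho; set A := [set x | f x \in Zl].
have A_x0 : x0 \in A by rewrite inE.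
have A_gt0 : 0 < (#|A|%:R : R) by rewrite ltr0n; apply/card_gt0P; exists x0.
have Zl_gt0 : (0 < #|Zl|)%N by apply/card_gt0P; exists (f x0).
apply: le_ereal_sup_tmp; eexists.
  by exists confusing_QR; first exact: confusing_QR_is_QR.
apply: le_ereal_inf_tmp => _ [Phat _ <-].
pose U := iid_pmf n (uniform_pmf R f_x0).
(* [output_pmf U Phat] is the mean estimate under the common law [U], so [x] depends on [Phat] but
   not on the observed outputs. *)
have [x] := exists_small_mass (output_pmf U Phat) A_x0.
rewrite inE => fx small_x; apply: le_ereal_sup_tmp; eexists.
  by exists (dirac_pmf R x).
apply: le_trans (iid_expectation_ge _ (fun z => KL_dirac_ge (Phat z) x A_gt0)).
under eq_bigr => z _.
  have -> : iid_pmf n (output_pmf (dirac_pmf R x) confusing_QR) z = U z.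
    by apply: eq_bigr => i _; apply: output_confusing_QR.
  over.
have -> : \sum_z U z * (log2 #|A|%:R + (1 - #|A|%:R * Phat z x) / ln 2) =
    log2 #|A|%:R + (1 - #|A|%:R * output_pmf U Phat x) / ln 2.
  move: (log2 _) => c.
  under eq_bigr do rewrite mulrDr mulrA mulrBr mulr1 mulrCA.
  by rewrite big_split /= -!mulr_suml sumrB -mulr_sumr (fpmf_sum1 U) mul1r.
(* The correction term is nonnegative by the choice of [x]. *)
by rewrite lee_fin lerDl divr_ge0 ?subr_ge0 // ltW // ln2_gt0.
Qed.

End Confusion.

Lemma sum_card_fibers Zl :
  (\sum_(j in Zl) #|[pred x | f x == j]|)%N = #|[set x | f x \in Zl]|.
Proof.
rewrite -sum1_card (partition_big f (mem Zl)) => [|x]; last by rewrite inE.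
apply: eq_bigr => j Zj; rewrite -sum1_card; apply: eq_bigl => x.
by rewrite !inE; case: eqP => [->|]; rewrite ?Zj ?andbF.
Qed.

(** The single label [f x0] already gives the logarithm of a positive integer. This serves the
    default values in [omega]. *)
Lemma privacy_ge0 (x0 : X) rho : rho <= 1 -> (0 <= privacy f n rho)%E.
Proof.
move=> rho_le1; have := @log2_card_le_privacy [set f x0] x0 rho (set11 _).
rewrite cards1 invr1 => /(_ rho_le1); apply: le_trans.
by rewrite lee_fin log2_nat_ge0.
Qed.

Lemma omega_le_privacy (x0 : X) rho :
  rho <= 1 -> ((omega f rho)%:E <= privacy f n rho)%E.
Proof.
move=> rho_le1; rewrite /omega; case: ifPn => [le_rho|_].
  (* With every label in [Zl], the confused points are all of [X]. *)
  have := @log2_card_le_privacy [set: 'I_k] x0 rho (finset.in_setT _).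
  rewrite cardsT card_ord => /(_ le_rho).
  by rewrite -[in X in _ -> X]cardsT; under eq_finset do rewrite finset.in_setT.
case: pickP => [l /and3P[l_gt0 _ le_rho]|_]; last exact: privacy_ge0.
(* The bound holds for the default 0 and is stable under maxima, which leaves a single [Zl] to
   treat. *)
apply: (big_ind (fun M => (M%:E <= privacy f n rho)%E)).
- exact: privacy_ge0.
- by move=> M M' leM leM'; rewrite EFin_max ge_max leM leM'.
move=> Zl /eqP card_Zl; rewrite sum_card_fibers.
(* [Zl] may miss the image of [f]; the convention [ln 0 = 0] then makes its term 0. *)
have [[x fx]|no_x] := pselect (exists x, f x \in Zl).
  by apply: log2_card_le_privacy fx _; rewrite card_Zl.
have -> : [set x | f x \in Zl] = finset.set0.
  by apply/setP => x; rewrite !inE; apply/negP => fx; apply: no_x; exists x.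
by rewrite cards0 /log2 ln0 // mul0r privacy_ge0.
Qed.

End Privacy.

Theorem theorem3 (R : realType) (X : finType) (r k : nat) (f : X -> 'I_k)
    (n : nat) (card_X : #|X| = r) (r_ge2 : (2 <= r)%N)
    (k_ge2 : (2 <= k)%N) (k_le_r : (k <= r)%N) (n_ge1 : (1 <= n)%N) :
  (forall rho rho' : R, 0 <= rho -> rho <= rho' -> rho' <= 1 ->
     (privacy f n rho' <= privacy f n rho)%E) /\
  (forall rho : R, 0 <= rho <= 1 -> ((omega f rho)%:E <= privacy f n rho)%E) /\
  (forall rho : R, 0 <= rho <= k%:R^-1 ->
     privacy f n rho = (omega f rho)%:E /\ omega f rho = log2 r%:R).
Proof.
have k_gt0 : (0 < k)%N by apply: ltnW.
have [x0 _] : exists x0, x0 \in X by apply/card_gt0P; rewrite card_X ltnW.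
have omega_le (rho : R) :
    rho <= 1 -> ((omega f rho)%:E <= privacy f n rho)%E.
  by apply: omega_le_privacy.
split=> [rho rho' _ le_rho _|]; first exact: privacy_nonincreasing.
split=> [rho /andP[_] | rho /andP[_ le_rho]]; first exact: omega_le.
have omegaE : omega f rho = log2 r%:R by rewrite /omega le_rho card_X.
(* The uniform guess gives the upper bound, the general inequality the lower one, as [k^-1 <= 1]. *)
split=> //; apply/le_anti/andP; split.
  by rewrite omegaE -card_X privacy_le.
by apply: omega_le; rewrite (le_trans le_rho) // invf_le1 ?ltr0n // ler1n.
Qed.
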